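(* Let $P(\mathcal{C})=\{\boldsymbol{x}_0,\dots,\boldsymbol{x}_{p^m-1}\}$ be a digital net over $\mathbb{Z}_p$ ($p$ prime) with dual net $\mathcal{D}(\mathcal{C})$ and associated wavenumber set $\mathcal{K}(\mathcal{C})$. Let $K:[0,1)^{2s}\to\mathbb{C}$ be a kernel of the form $$K(\boldsymbol{x},\boldsymbol{y})=K(\boldsymbol{x}\ominus\boldsymbol{y},\boldsymbol{0})=\sum_{\boldsymbol{k}\in\mathbb{N}_0^s}\widehat K(\boldsymbol{k})\,\mathrm{wal}_{\boldsymbol{k}}(\boldsymbol{x}\ominus\boldsymbol{y}),$$ where $\widehat K(\boldsymbol{k})$ is real and non-negative for all $\boldsymbol{k}\in\mathbb{N}_0^s$ and $\widehat K$ is summable. Let $f\in\mathcal{H}_K$, the Hilbert space with reproducing kernel $K$, and let $$Sf(\boldsymbol{x})=\sum_{n=0}^{p^m-1}c_n\,K(\boldsymbol{x},\boldsymbol{x}_n)$$ be the spline whose coefficients $c_n$ are determined by interpolation, $f(\boldsymbol{x}_n)=Sf(\boldsymbol{x}_n)$ for $n=0,\dots,p^m-1$. Then for any $\boldsymbol{k}\in\mathcal{K}(\mathcal{C})$, $$\widetilde f(\boldsymbol{k})=p^m\,\widetilde K(\boldsymbol{k})\,\widetilde c(\boldsymbol{k}),\qquad\text{which implies}\qquad \widetilde c(\boldsymbol{k})=\frac{\widetilde f(\boldsymbol{k})}{p^m\,\widetilde K(\boldsymbol{k})},$$ where $\widetilde f(\boldsymbol{k})=p^{-m}\sum_{n=0}^{p^m-1}f(\boldsymbol{x}_n)\overline{\mathrm{wal}_{\boldsymbol{k}}(\boldsymbol{x}_n)}$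 and $\widetilde c(\boldsymbol{k})=p^{-m}\sum_{n=0}^{p^m-1}c_n\overline{\mathrm{wal}_{\boldsymbol{k}}(\boldsymbol{x}_n)}$ are the discrete Walsh transforms of the function data and of the coefficients, and $\widetilde K(\boldsymbol{k})=\sum_{\boldsymbol{l}\in\mathcal{D}(\mathcal{C})}\widehat K(\boldsymbol{k}\oplus\boldsymbol{l})$ is the discrete Walsh transform of the kernel data $(K(\boldsymbol{x}_n,\boldsymbol{0}))_{n=0}^{p^m-1}$. Moreover, given the function values $f(\boldsymbol{x}_n)$ and the kernel values $K(\boldsymbol{x}_n,\boldsymbol{x}_v)$, all of $(\widetilde f(\boldsymbol{k}))_{\boldsymbol{k}\in\mathcal{K}(\mathcal{C})}$, $(\widetilde K(\boldsymbol{k}))_{\boldsymbol{k}\in\mathcal{K}(\mathcal{C})}$, hence $(\widetilde c(\boldsymbol{k}))_{\boldsymbol{k}\in\mathcal{K}(\mathcal{C})}$, and the coefficients $c_0,\dots,c_{p^m-1}$ can be computed in $O(m\,p^m\log p)$ operations.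
   Context: $p$ is prime, $\mathbb{Z}_p=\{0,\dots,p-1\}$ is the finite field of order $p$, $\mathbb{N}_0$ is the set of non-negative integers, $\omega_p=e^{2\pi i/p}$, and the bar denotes complex conjugation. Digital net: $\mathcal{C}=(C_1,\dots,C_s)$, where $C_1,\dots,C_s$ are $m\times m$ matrices over $\mathbb{Z}_p$. For $0\le n<p^m$ with base $p$ representation $n=n_0+n_1p+\cdots+n_{m-1}p^{m-1}$ let $\vec n=(n_0,\dots,n_{m-1})^T\in\mathbb{Z}_p^m$, $(y_{j,n,1},\dots,y_{j,n,m})^T=C_j\vec n\in\mathbb{Z}_p^m$, $x_{j,n}=y_{j,n,1}p^{-1}+\cdots+y_{j,n,m}p^{-m}$, and $\boldsymbol{x}_n=(x_{1,n},\dots,x_{s,n})$. Then $P(\mathcal{C})=\{\boldsymbol{x}_0,\dots,\boldsymbol{x}_{p^m-1}\}$. Walsh functions: for $k=k_0+k_1p+\cdots+k_{a-1}p^{a-1}\in\mathbb{N}_0$ with $k_i\in\mathbb{Z}_p$ and $x\in[0,1)$ with base $p$ representation $x=x_1/p+x_2/p^2+\cdots$ (infinitely many $x_i$ different from $p-1$), $\mathrm{wal}_k(x)=\omega_p^{x_1k_0+\cdots+x_ak_{a-1}}$. For $\boldsymbol{k}\in\mathbb{N}_0^s$ and $\boldsymbol{x}\in[0,1)^s$, $\mathrm{wal}_{\boldsymbol{k}}(\boldsymbol{x})=\prod_{j=1}^s\mathrm{wal}_{k_j}(x_j)$. $\oplus$ and $\ominus$ denote digit-wise addition and subtraction modulo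 $p$ of base $p$ digits (without carry), applied componentwise to vectors. Dual net and cosets: for $\boldsymbol{k}\in\mathbb{N}_0^s$ with $k_j=k_{j,0}+k_{j,1}p+\cdots$ let $\vec k_j^{(m)}=(k_{j,0},\dots,k_{j,m-1})^T\in\mathbb{Z}_p^m$ and $\mathcal{C}\cdot\boldsymbol{k}=C_1^T\vec k_1^{(m)}+\cdots+C_s^T\vec k_s^{(m)}\in\mathbb{Z}_p^m$. The dual net is $\mathcal{D}(\mathcal{C})=\{\boldsymbol{k}\in\mathbb{N}_0^s:\mathcal{C}\cdot\boldsymbol{k}=\vec 0\}$, a subgroup of $(\mathbb{N}_0^s,\oplus)$. Its cosets are given by $\mathcal{D}(\vec h)=\{\boldsymbol{k}\in\mathbb{N}_0^s:\mathcal{C}\cdot\boldsymbol{k}=\vec h\}$ for $\vec h\in\mathbb{Z}_p^m$, $p^m$ cosets in all. The set $\mathcal{K}(\mathcal{C})$: let $\nu(0)=0$, $\nu(k)=1+\max\{i:k_i\ne0\}$ for $k=k_0+k_1p+\cdots>0$, and $\nu(\boldsymbol{k})=\sum_{j=1}^s\nu(k_j)$. $\mathcal{K}(\mathcal{C})$ is obtained by choosing exactly one representative in each coset: for each $\vec h\in\mathbb{Z}_p^m$, the $\boldsymbol{k}\in\mathcal{D}(\vec h)$ such that $\nu(\boldsymbol{k})\le\nu(\boldsymbol{l})$ for all $\boldsymbol{l}\in\mathcal{D}(\vec h)$, and, if more than one $\boldsymbol{k}$ in the coset satisfies this, the smallest of them in lexicographic order. $\mathcal{H}_K$ is the completion of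 the space of finite linear combinations of the functions $K(\cdot,\boldsymbol{x}')$, $\boldsymbol{x}'\in[0,1)^s$, in the inner product determined by $K$, so that $f(\boldsymbol{y})=\langle K(\cdot,\boldsymbol{y}),f\rangle$ for all $\boldsymbol{y}\in[0,1)^s$ and $f\in\mathcal{H}_K$; in terms of Walsh coefficients $\widehat f(\boldsymbol{k})=\int_{[0,1]^s}f(\boldsymbol{x})\overline{\mathrm{wal}_{\boldsymbol{k}}(\boldsymbol{x})}\,d\boldsymbol{x}$, its inner product is $\langle f,g\rangle_{\mathcal{H}_K}=\sum_{\boldsymbol{k}\in\mathbb{N}_0^s}\widehat f(\boldsymbol{k})\overline{\widehat g(\boldsymbol{k})}/\widehat K(\boldsymbol{k})$. *)

(* Defs.v *)
From HB Require Import structures.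
From mathcomp Require Import all_boot all_order all_algebra finmap.
From mathcomp Require Import summability.
From mathcomp Require Import all_classical all_reals all_analysis.
From mathcomp.real_closed Require Import complex.
Set Implicit Arguments.
Unset Strict Implicit.
Unset Printing Implicit Defensive.
Import Order.TTheory GRing.Theory Num.Theory.
Import numFieldNormedType.Exports.
Local Open Scope classical_set_scope.
Local Open Scope complex_scope.
Local Open Scope ring_scope.

(* Points of [0,1)^s are row vectors ('rV[R]_s, restricted to [cube]) and
   wavenumbers are tuples (s.-tuple nat).  Functions on [0,1)^s are total
   functions on 'rV[R]_s whose values outside the cube are never used. *)

Section Digits.
Variable p : nat.

Definition ndigit (k i : nat) : nat := ((k %/ p ^ i) %% p)%N.

(* Since k_i <> 0 forces i < p ^ i <= k, bounding i by k loses nothing. *)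
Definition nu (k : nat) : nat := (\max_(i < k | ndigit k i != 0) i.+1)%N.

Definition nus s (k : s.-tuple nat) : nat := (\sum_(j < s) nu (tnth k j))%N.

Definition nadd (k l : nat) : nat :=
  (\sum_(i < maxn (nu k) (nu l)) ((ndigit k i + ndigit l i) %% p) * p ^ i)%N.

Definition wadd s (k l : s.-tuple nat) : s.-tuple nat :=
  [tuple nadd (tnth k j) (tnth l j) | j < s].

Variable R : realType.

(* [rdigit x i] is the digit x_{i+1} of x = x_1/p + x_2/p^2 + ...; for x in
   [0,1) the floor formula yields the expansion in which infinitely many
   digits differ from p - 1. *)
Definition rdigit (x : R) (i : nat) : nat :=
  (Num.truncn (x * p%:R ^+ i.+1) %% p)%N.

(* Digit sequence of x (-) y: entrywise subtraction modulo p, no carry. *)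
Definition dsub (x y : R) (i : nat) : nat :=
  ((rdigit x i + (p - rdigit y i)) %% p)%N.

Definition proper_digits (d : nat -> nat) : Prop :=
  forall N, exists2 i, (N <= i)%N & d i != p.-1.

Definition digits_val (d : nat -> nat) : R :=
  limn (series (fun i => (d i)%:R / p%:R ^+ i.+1 : R)).

Definition osub s (x y : 'rV[R]_s) : 'rV[R]_s :=
  \row_j digits_val (dsub (x 0 j) (y 0 j)).

Definition omega : R[i] := cos (2 * pi / p%:R) +i* sin (2 * pi / p%:R).

(* Walsh functions only read base p digits.  They are defined on digit
   sequences because the digits of x (-) y may all equal p - 1 from some place
   on: the real number they represent then has another expansion (or is 1),
   and wal_k(x (-) y) has to refer to the digits of x (-) y themselves. *)
Definition wal_digits (k : nat) (d : nat -> nat) : R[i] :=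
  omega ^+ (\sum_(i < nu k) d i * ndigit k i)%N.

Definition wal s (k : s.-tuple nat) (x : 'rV[R]_s) : R[i] :=
  \prod_(j < s) wal_digits (tnth k j) (rdigit (x 0 j)).

Definition wal_osub s (k : s.-tuple nat) (x y : 'rV[R]_s) : R[i] :=
  \prod_(j < s) wal_digits (tnth k j) (dsub (x 0 j) (y 0 j)).

End Digits.

Definition cube (R : realType) s : set 'rV[R]_s :=
  [set x | forall j, 0 <= x 0 j < 1].

Section Net.
Variables (p s m : nat) (C : 'I_s -> 'M['F_p]_m).

Definition digitvec (k : nat) : 'cV['F_p]_m := \col_(i < m) (ndigit p k i)%:R.

Definition netpoint (R : realType) (n : 'I_(p ^ m)) : 'rV[R]_s :=
  \row_j \sum_(i < m) ((C j *m digitvec n) i 0 : nat)%:R / p%:R ^+ i.+1.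

Definition netdot (k : s.-tuple nat) : 'cV['F_p]_m :=
  \sum_(j < s) (C j)^T *m digitvec (tnth k j).

Definition coset_net (h : 'cV['F_p]_m) : set (s.-tuple nat) :=
  [set k | netdot k = h].

Definition dual_net : set (s.-tuple nat) := coset_net 0.

Definition wavenumbers : set (s.-tuple nat) :=
  [set k | exists2 h, coset_net h k &
     forall l, coset_net h l ->
       (nus p k <= nus p l)%N /\
       (nus p l = nus p k -> @Order.le _ (s.-tuplelexi nat) k l)].

Variable R : realType.

Definition dwt (g : 'I_(p ^ m) -> R[i]) (k : s.-tuple nat) : R[i] :=
  (p%:R ^+ m)^-1 * \sum_n g n * (wal p k (netpoint R n))^*%R.

Definition Ktilde (Khat : s.-tuple nat -> R) (k : s.-tuple nat) : R :=
  fine (\esum_(l in dual_net) (Khat (wadd p k l))%:E).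

Definition spline (K : 'rV[R]_s -> 'rV[R]_s -> R[i]) (c : 'I_(p ^ m) -> R[i])
    (x : 'rV[R]_s) : R[i] :=
  \sum_n c n * K x (netpoint R n).

Definition interpolates (K : 'rV[R]_s -> 'rV[R]_s -> R[i])
    (f : 'rV[R]_s -> R[i]) (c : 'I_(p ^ m) -> R[i]) : Prop :=
  forall n, f (netpoint R n) = spline K c (netpoint R n).

End Net.

(* K(x,y) = K(x (-) y, 0) is required where x (-) y is a point of the cube
   whose base p expansion is its digit sequence; the series converges
   unconditionally. *)
Definition walsh_kernel (R : realType) (p s : nat) (Khat : s.-tuple nat -> R)
    (K : 'rV[R]_s -> 'rV[R]_s -> R[i]) : Prop :=
  forall x y, cube x -> cube y ->
    ((forall j, proper_digits p (dsub p (x 0 j) (y 0 j))) ->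
       K x y = K (osub p x y) 0) /\
    (partial_sum (fun k => ((Khat k)%:C * wal_osub p k x y : R[i]^o)) @ totally
       --> (K x y : R[i]^o)).

Section RKHS.
Variables (R : realType) (s : nat) (K : 'rV[R]_s -> 'rV[R]_s -> R[i]).

(* A list of pairs (a, x) stands for the linear combination of the functions
   a K(., x). *)
Definition kcomb (g : seq (R[i] * 'rV[R]_s)) (y : 'rV[R]_s) : R[i] :=
  \sum_(a <- g) a.1 * K y a.2.

Definition kcomb_sub (g h : seq (R[i] * 'rV[R]_s)) :=
  g ++ [seq (- a.1, a.2) | a <- h].

(* Square of the norm determined by K, i.e. by <K(., x), K(., y)> = K(y, x). *)
Definition knorm2 (g : seq (R[i] * 'rV[R]_s)) : R[i] :=
  \sum_(a <- g) \sum_(b <- g) a.1 * b.1^*%R * K b.2 a.2.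

(* The completion of the span of the K(., x), realized as a space of functions
   on the cube: by the reproducing property an element of the completion has
   the pointwise limit of a Cauchy sequence representing it as values. *)
Definition in_RKHS (f : 'rV[R]_s -> R[i]) : Prop :=
  exists g : nat -> seq (R[i] * 'rV[R]_s),
    [/\ forall i a, a \in g i -> cube a.2,
        forall e : R, 0 < e -> exists N, forall i j, (N <= i)%N -> (N <= j)%N ->
          `|knorm2 (kcomb_sub (g i) (g j))| < e%:C
      & forall y, cube y -> (kcomb (g i) y : R[i]^o) @[i --> \oo] --> (f y : R[i]^o)].

End RKHS.

(* Straight-line programs over a field F with inputs indexed by I.  Every
   instruction (loading a constant included) appends one register and counts
   as one operation; a division by zero leaves its register undefined. *)
Section StraightLine.
Variables (F : fieldType) (I : Type).

Inductive operand := Input of I | Reg of nat.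

Inductive instr :=
  | Const of F
  | Add of operand & operand
  | Sub of operand & operand
  | Mul of operand & operand
  | Div of operand & operand.

Definition read (inp : I -> F) (regs : seq (option F)) (o : operand) :
    option F :=
  match o with Input i => Some (inp i) | Reg r => nth None regs r end.

Definition bin (op : F -> F -> option F) (u v : option F) : option F :=
  if (u, v) is (Some a, Some b) then op a b else None.

Definition exec (inp : I -> F) (regs : seq (option F)) (c : instr) :
    option F :=
  let rd := read inp regs in
  match c with
  | Const a => Some a
  | Add u v => bin (fun a b => Some (a + b)) (rd u) (rd v)
  | Sub u v => bin (fun a b => Some (a - b)) (rd u) (rd v)
  | Mul u v => bin (fun a b => Some (a * b)) (rd u) (rd v)
  | Div u v =>
      bin (fun a b => if b == 0 then None else Some (a / b)) (rd u) (rd v)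
  end.

Definition run (inp : I -> F) (P : seq instr) : seq (option F) :=
  foldl (fun regs c => rcons regs (exec inp regs c)) [::] P.

Definition output (inp : I -> F) (P : seq instr) (o : operand) : option F :=
  read inp (run inp P) o.

End StraightLine.

Arguments Input {I}.
Arguments Reg {I}.

(* The data: the values f(x_n), and the values K(x_n, x_v). *)
Definition spline_data (R : realType) (p s m : nat) (C : 'I_s -> 'M['F_p]_m)
    (K : 'rV[R]_s -> 'rV[R]_s -> R[i]) (f : 'rV[R]_s -> R[i])
    (z : 'I_(p ^ m) + 'I_(p ^ m) * 'I_(p ^ m)) : R[i] :=
  match z with
  | inl n => f (netpoint C R n)
  | inr (n, v) => K (netpoint C R n) (netpoint C R v)
  end.

(* Main.v *)
Require Import Defs.
From HB Require Import structures.
From mathcomp Require Import all_boot all_order all_algebra finmap.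
From mathcomp Require Import summability.
From mathcomp Require Import all_classical all_reals all_analysis.
From mathcomp.real_closed Require Import complex.
From mathcomp Require Import ring lra.
Set Implicit Arguments.
Unset Strict Implicit.
Unset Printing Implicit Defensive.
Import Order.TTheory GRing.Theory Num.Theory.
Import numFieldNormedType.Exports.
Local Open Scope classical_set_scope.
Local Open Scope complex_scope.
Local Open Scope ring_scope.

(** Write [dvec n] for the digit vector of the index [n], [chi] for the
    additive character x |-> omega^x of 'F_p, and [dot] for the bilinear form
    u^T v on 'F_p^m.  A Walsh function only sees the point x_n through its
    digits C_j n, so wal_k(x_n) = chi (dot n (C . k)) ([wal_netpoint]): the
    discrete Walsh transform at k is the Fourier transform on the group 'F_p^m
    at h = C . k ([dwtE]), whichever representative k of the coset is chosen.
    Grouping the absolutely convergent kernel series by cosets gives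
      K(x_n, x_v) = sum_h kappa(h) chi (dot (n - v) h),
    where kappa(h) is the sum of Khat over the coset of h
    ([kernel_netpoint]).  The interpolation matrix is therefore a convolution
    on 'F_p^m and is diagonalized by the Fourier transform, with eigenvalues
    p^m kappa(h) ([fourier_interpolates]).  Translation by k is a bijection
    from the dual net onto the coset of C . k ([wadd_bij]), which identifies
    kappa(C . k) with Ktilde(k) ([KtildeE]).  If kappa(h) = 0 for some h,
    adding the character of frequency h to the coefficients leaves the spline
    unchanged at the nodes, so uniqueness of the coefficients forces all
    eigenvalues to be nonzero ([unique_kappa_neq0]).

    The operation count is that of three Fourier transforms on 'F_p^m: of the
    data, of the column K(x_n, 0) of kernel values, and, after dividing the
    first by p^m times the second, one inverse transform.  Such a transform is
    m passes of p^(m-1) transforms of length p ([cost_tensor],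
    [cost_multidim]), and it remains to transform a vector of prime length p
    with O(p log p) operations.  Bluestein's chirp identity
      j k = 'C(j + k, 2) - 'C(j, 2) - 'C(k, 2)
    turns it into a correlation ([cost_bluestein]), which two radix-2
    transforms of a length 2^r between 2 p and 4 p compute ([cost_fft]).

    Cost is measured on maps between families of values: [cost N L] says that
    at most N instructions, appended to a program that makes a family a
    available, make L a available too.  This predicate is stable
    under composition and under finite families, so that programs are never
    written down.  *)

(** * Base p digits *)

Lemma ndigit0 p n : ndigit p n 0 = (n %% p)%N.
Proof. by rewrite /ndigit expn0 divn1. Qed.

Lemma ndigitS p n i : ndigit p n i.+1 = ndigit p (n %/ p) i.
Proof. by rewrite /ndigit expnS divnMA. Qed.

Section Digits.
Variable p : nat.
Hypothesis p1 : (1 < p)%N.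

Let p0 : (0 < p)%N := ltnW p1.

Lemma ndigit_lt k i : (ndigit p k i < p)%N.
Proof. by rewrite ltn_mod. Qed.

Lemma ndigit_small k i : (k < p ^ i)%N -> ndigit p k i = 0%N.
Proof. by move=> kp; rewrite /ndigit divn_small ?mod0n. Qed.

Lemma ndigit_nu k i : (nu p k <= i)%N -> ndigit p k i = 0%N.
Proof.
move=> ki; apply/eqP; apply: contraTT ki => di; rewrite -ltnNge.
have ik : (i < k)%N.
  apply: leq_trans (ltn_expl i p1) _; rewrite leqNgt.
  by apply: contra di => /ndigit_small ->.
exact: (leq_bigmax_cond (Ordinal ik)).
Qed.

(** Both numbers are below p^N for a common N, and removing the last digit lowers
    N by one. *)
Lemma ndigit_inj k l : ndigit p k =1 ndigit p l -> k = l.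
Proof.
have: (k < p ^ maxn k l)%N.
  by apply: leq_trans (ltn_expl k p1) _; rewrite leq_exp2l ?leq_maxl.
have: (l < p ^ maxn k l)%N.
  by apply: leq_trans (ltn_expl l p1) _; rewrite leq_exp2l ?leq_maxr.
move: (maxn k l) => N; elim: N k l => [|N IH] k l; first by rewrite !ltnS !leqn0 => /eqP-> /eqP->.
move=> lN kN e; rewrite (divn_eq k p) (divn_eq l p).
have := e 0%N; rewrite !ndigit0 => ->; congr (_ * _ + _)%N.
by apply: IH => [||i]; rewrite ?ltn_divLR // -?expnSr // -!ndigitS e.
Qed.

Lemma ndigit_sum N (d : nat -> nat) i : (forall i, (d i < p)%N) ->
  ndigit p (\sum_(i < N) d i * p ^ i)%N i = if (i < N)%N then d i else 0%N.
Proof.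
move=> dp; elim: N d dp i => [|N IH] d dp i.
  by rewrite big_ord0 /ndigit div0n mod0n.
rewrite big_ord_recl expn0 muln1.
under eq_bigr => j _ do rewrite lift0 expnSr mulnA.
rewrite -big_distrl /= addnC; case: i => [|i].
  by rewrite ndigit0 modnMDl modn_small.
by rewrite ndigitS divnMDl // divn_small // addn0 (IH (fun i => d i.+1)).
Qed.

Lemma ndigit_nadd k l i :
  ndigit p (nadd p k l) i = ((ndigit p k i + ndigit p l i) %% p)%N.
Proof.
rewrite (ndigit_sum _ (d := fun i => (ndigit p k i + ndigit p l i) %% p)%N).
  case: ifP => // /negbT; rewrite -leqNgt geq_max => /andP[ki li].
  by rewrite !ndigit_nu ?mod0n.
by move=> j; rewrite ltn_mod.
Qed.

(** Lets the digit sums of Walsh functions, which run up to [nu], run up to the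
    number m of rows instead. *)
Lemma sum_nat_support N M (F : nat -> nat) :
  (forall i, (N <= i)%N -> F i = 0%N) -> (forall i, (M <= i)%N -> F i = 0%N) ->
  (\sum_(i < N) F i = \sum_(i < M) F i)%N.
Proof.
wlog le : N M / (N <= M)%N => [H HN HM|HN _].
  by case: (leqP N M) => [/H|/ltnW/H ->]; [apply|by []..].
rewrite -(subnKC le) big_split_ord /= [X in (_ + X)%N]big1 ?addn0 // => i _.
by rewrite HN ?leq_addr.
Qed.

Variable R : realType.

(** Horner's scheme: x = (y_0 + x') / p with x' of the same form and in [0,1), so
    the first digit of x is y_0 and the following ones are the digits of x'.  The
    bounds on x' are what makes the induction go through. *)
Lemma rdigit_sum m (y : nat -> nat) (x : R) : (forall i, (y i < p)%N) ->
  x = \sum_(i < m) (y i)%:R / p%:R ^+ i.+1 ->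
  0 <= x < 1 /\ forall i, rdigit p x i = if (i < m)%N then y i else 0%N.
Proof.
have pR : 0 < p%:R :> R by rewrite ltr0n.
move=> yp ->; elim: m y yp => [|m IH] y yp.
  by rewrite big_ord0 lexx ltr01; split=> // i; rewrite /rdigit mul0r truncn0 mod0n.
have := IH (fun i => y i.+1) (fun i => yp i.+1).
set x' := \sum_(i < m) _ => -[/andP[x0 x1] Hx].
have -> : \sum_(i < m.+1) (y i)%:R / p%:R ^+ i.+1 = ((y 0%N)%:R + x') / p%:R.
  rewrite big_ord_recl mulrDl expr1; congr (_ + _); rewrite mulr_suml.
  by apply: eq_bigr => i _; rewrite -mulrA -invfM -exprSr lift0.
split.
  rewrite divr_ge0 ?addr_ge0 ?ler0n //= ltr_pdivrMr // mul1r.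
  apply: lt_le_trans (_ : (y 0%N)%:R + 1 <= _); first by rewrite ltrD2l.
  by rewrite natr1 ler_nat.
case=> [|i].
  rewrite /rdigit expr1 divfK ?gt_eqF // truncnD ?natr_nat // natrK.
  have -> : Num.truncn x' = 0%N by apply: truncn_def; rewrite x0.
  by rewrite addn0 modn_small.
rewrite ltnS -Hx /rdigit [p%:R ^+ i.+2]exprS mulrA divfK ?gt_eqF // mulrDl.
have yN : (y 0%N)%:R * p%:R ^+ i.+1 \in (Num.nat : {pred R}).
  by rewrite rpredM ?rpredX ?natr_nat.
rewrite truncnD //; last by rewrite nnegrE mulr_ge0 // exprn_ge0 // ltW.
by rewrite -natrX -natrM natrK expnSr mulnA modnMDl.
Qed.

End Digits.

(** * Straight-line programs and their cost *)

Section Availability.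
Variables (F : fieldType) (I : Type).
Implicit Types (P Q : seq (instr F I)) (D : (I -> F) -> Prop)
  (g : (I -> F) -> F) (inp : I -> F).

(** The operand has to hold the value in every extension of the program: then
    availability survives appending instructions ([avail_cat]) with no bookkeeping
    on register numbers.  The domain [D] restricts the inputs, since a quotient is
    only available where its denominator does not vanish. *)
Definition avail D P g : Prop :=
  exists o, forall Q inp, D inp -> output inp (P ++ Q) o = Some (g inp).

Lemma avail_cat D P Q g : avail D P g -> avail D (P ++ Q) g.
Proof. by case=> o Ho; exists o => Q' inp Dinp; rewrite -catA Ho. Qed.

Lemma avail_sub D E P g : (forall inp, E inp -> D inp) ->
  avail D P g -> avail E P g.
Proof. by move=> sED; case=> o Ho; exists o => Q inp /sED; apply: Ho. Qed.

Lemma eq_avail D P g g' : (forall inp, D inp -> g inp = g' inp) ->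
  avail D P g -> avail D P g'.
Proof. by move=> e; case=> o Ho; exists o => Q inp Di; rewrite Ho ?e. Qed.

Lemma avail_input D P i : avail D P (fun inp => inp i).
Proof. by exists (Input i). Qed.

Lemma size_run inp P : size (run inp P) = size P.
Proof.
by elim/last_ind: P => // P c IH; rewrite /run foldl_rcons !size_rcons -/(run _ _) IH.
Qed.

(** Registers are never overwritten. *)
Lemma run_cat inp P Q : exists regs, run inp (P ++ Q) = run inp P ++ regs.
Proof.
elim/last_ind: Q => [|Q c [regs IH]]; first by exists [::]; rewrite !cats0.
rewrite -rcons_cat /run foldl_rcons -/(run _ _) IH.
by eexists; rewrite rcons_cat.
Qed.

Lemma avail_step D P c g :
  (forall inp, D inp -> exec inp (run inp P) c = Some (g inp)) ->
  avail D (rcons P c) g.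
Proof.
move=> Hc; exists (Reg (size P)) => Q inp Dinp.
rewrite /output /=; have [regs ->] := run_cat inp (rcons P c) Q.
rewrite nth_cat size_run size_rcons ltnSn.
by rewrite /run foldl_rcons -/(run _ _) nth_rcons size_run ltnn eqxx Hc.
Qed.

Lemma avail_read D P g : avail D P g ->
  exists o, forall inp, D inp -> read inp (run inp P) o = Some (g inp).
Proof.
by case=> o Ho; exists o => inp /(Ho [::]); rewrite cats0.
Qed.

Lemma avail_div D P g g' : (forall inp, D inp -> g' inp != 0) ->
    avail D P g -> avail D P g' ->
  exists c, avail D (rcons P c) (fun inp => g inp / g' inp).
Proof.
move=> nz /avail_read[ o Ho] /avail_read[ o' Ho']; exists (Div F o o').
by apply: avail_step => inp Di; rewrite /= Ho ?Ho' // /bin ifN ?nz.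
Qed.

End Availability.

(** Each quotient is available on its own domain, so that one vanishing denominator
    does not spoil the other quotients. *)
Lemma avail_divs (F : fieldType) (I : Type) (U : finType)
    (D : (I -> F) -> Prop) (P : seq (instr F I)) (a b : U -> (I -> F) -> F) :
    (forall u, avail D P (a u)) -> (forall u, avail D P (b u)) ->
  exists2 Q, (size Q <= #|U|)%N &
    forall u, avail (fun inp => D inp /\ b u inp != 0) (P ++ Q)
      (fun inp => a u inp / b u inp).
Proof.
move=> Ha Hb.
suff [Q sQ HQ] : exists2 Q, (size Q <= size (enum U))%N &
    forall u, u \in enum U -> avail (fun inp => D inp /\ b u inp != 0) (P ++ Q)
      (fun inp => a u inp / b u inp).
  by exists Q => [|u]; [rewrite cardE | apply: HQ; rewrite mem_enum].
elim: (enum U) => [|u s [Q sQ HQ]]; first by exists [::].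
have [|||c Hc] := @avail_div F I (fun inp => D inp /\ b u inp != 0) (P ++ Q) (a u) (b u).
- by move=> inp [].
- by apply/avail_cat/(avail_sub _ (Ha u)) => inp [].
- by apply/avail_cat/(avail_sub _ (Hb u)) => inp [].
exists (rcons Q c) => [|v]; first by rewrite size_rcons.
rewrite in_cons -rcons_cat => /orP[/eqP->//|vs].
by rewrite -cats1; apply: avail_cat; apply: HQ.
Qed.

Section Cost.
Variable F : fieldType.

(** Only the existence of suitable instructions is recorded, uniformly in the
    program that they extend, in the index type of its inputs and in the domain. *)
Definition cost (T U : Type) (N : nat) (L : (T -> F) -> U -> F) : Prop :=
  forall I (D : (I -> F) -> Prop) (P : seq (instr F I)) (a : T -> (I -> F) -> F),
    (forall t, avail D P (a t)) ->
  exists2 Q, (size Q <= N)%N &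
    forall u, avail D (P ++ Q) (fun inp => L (fun t => a t inp) u).

(** Cost of a scalar-valued map, in the form that [cost_pointwise] assembles into
    families. *)
Definition scost (T : Type) (N : nat) (e : (T -> F) -> F) : Prop :=
  cost N (fun a (_ : unit) => e a).

Lemma sub_cost T U N N' (L L' : (T -> F) -> U -> F) : cost N L ->
  (N <= N')%N -> (forall a u, L a u = L' a u) -> cost N' L'.
Proof.
move=> H le e I D P a Ha; have [Q sQ HQ] := H I D P a Ha.
exists Q => [|u]; first exact: leq_trans le.
by apply: eq_avail (HQ u) => inp _; rewrite e.
Qed.

Lemma cost_comp T U V N N' (L : (T -> F) -> U -> F) (L' : (U -> F) -> V -> F) :
  cost N L -> cost N' L' -> cost (N + N') (fun a => L' (L a)).
Proof.
move=> H H' I D P a Ha; have [Q sQ HQ] := H I D P a Ha.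
have [Q' sQ' HQ'] := H' _ _ _ _ HQ.
by exists (Q ++ Q'); [rewrite size_cat leq_add | move=> v; rewrite catA].
Qed.

Lemma cost_reindex T U (r : U -> T) : cost 0 (fun (a : T -> F) u => a (r u)).
Proof. by move=> I D P a Ha; exists [::] => // u; rewrite cats0. Qed.

Lemma cost_family T U (J : finType) N (L : J -> (T -> F) -> U -> F) :
  (forall j, cost N (L j)) ->
  cost (#|J| * N) (fun a (ju : J * U) => L ju.1 a ju.2).
Proof.
move=> H I D P a Ha.
suff [Q sQ HQ] : exists2 Q, (size Q <= size (enum J) * N)%N &
    forall j u, j \in enum J ->
      avail D (P ++ Q) (fun inp => L j (fun t => a t inp) u).
  exists Q; first by rewrite cardE.
  by move=> [j u]; apply: HQ; rewrite mem_enum.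
elim: (enum J) => [|j s [Q sQ HQ]]; first by exists [::].
have [t|Q' sQ' HQ'] := H j I D (P ++ Q) a; first exact: avail_cat.
exists (Q ++ Q') => [|j' u]; first by rewrite size_cat mulSn addnC leq_add.
rewrite in_cons catA => /orP[/eqP->//|js].
by apply: avail_cat; apply: HQ.
Qed.

Lemma cost_pointwise T (U : finType) N (e : U -> (T -> F) -> F) :
  (forall u, scost N (e u)) -> cost (#|U| * N) (fun a u => e u a).
Proof.
move=> H; have := cost_comp (cost_family (L := fun u a (_ : unit) => e u a) H)
  (cost_reindex (fun u : U => (u, tt))).
by rewrite addn0.
Qed.

Lemma scost_var T (t : T) : scost 0 (fun a : T -> F => a t).
Proof. exact: (cost_reindex (fun _ : unit => t)). Qed.

Lemma scost_const T (x : F) : scost 1 (fun _ : T -> F => x).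
Proof.
move=> I D P a Ha; exists [:: Const I x] => // _.
by rewrite cats1; apply: avail_step.
Qed.

Lemma scost_add T N N' (e e' : (T -> F) -> F) :
  scost N e -> scost N' e' -> scost (N + N').+1 (fun a => e a + e' a).
Proof.
move=> H H' I D P a Ha; have [Q sQ HQ] := H I D P a Ha.
have [t|Q' sQ' HQ'] := H' I D (P ++ Q) a; first exact: avail_cat.
have /avail_read[ o Ho] := avail_cat Q' (HQ tt).
have /avail_read[ o' Ho'] := HQ' tt.
exists (rcons (Q ++ Q') (Add F o o')) => [|_].
  by rewrite size_rcons size_cat ltnS leq_add.
by rewrite -rcons_cat catA; apply: avail_step => inp Di /=; rewrite Ho ?Ho'.
Qed.

Lemma scost_mul T N N' (e e' : (T -> F) -> F) :
  scost N e -> scost N' e' -> scost (N + N').+1 (fun a => e a * e' a).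
Proof.
move=> H H' I D P a Ha; have [Q sQ HQ] := H I D P a Ha.
have [t|Q' sQ' HQ'] := H' I D (P ++ Q) a; first exact: avail_cat.
have /avail_read[ o Ho] := avail_cat Q' (HQ tt).
have /avail_read[ o' Ho'] := HQ' tt.
exists (rcons (Q ++ Q') (Mul F o o')) => [|_].
  by rewrite size_rcons size_cat ltnS leq_add.
by rewrite -rcons_cat catA; apply: avail_step => inp Di /=; rewrite Ho ?Ho'.
Qed.

Lemma cost_scale (T : finType) (x : T -> F) :
  cost (#|T| * 2) (fun a t => x t * a t).
Proof.
apply: (cost_pointwise (e := fun t a => x t * a t)) => t.
exact: (scost_mul (scost_const (x t)) (scost_var t)).
Qed.

End Cost.

(** * Fast Fourier transforms *)

Section FastTransforms.
Variable F : fieldType.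

(** The linear map with matrix M, acting on row vectors. *)
Definition lin (T U : finType) (M : T -> U -> F) (a : T -> F) (u : U) : F :=
  \sum_t a t * M t u.

(** Row-column algorithm: the map with matrix M1 (x) M2 is M1 applied along the first
    coordinate, once for each t2, followed by M2 along the second, once for each u1. *)
Lemma cost_tensor (T1 T2 U1 U2 : finType) (M1 : T1 -> U1 -> F)
    (M2 : T2 -> U2 -> F) N1 N2 :
  cost N1 (lin M1) -> cost N2 (lin M2) ->
  cost (#|T2| * N1 + #|U1| * N2)
    (lin (fun (t : T1 * T2) (u : U1 * U2) => M1 t.1 u.1 * M2 t.2 u.2)).
Proof.
move=> H1 H2.
have K1 : forall t2 : T2, cost N1
    (fun (a : T1 * T2 -> F) => lin M1 (fun t1 => a (t1, t2))).
  by move=> t2; exact: (cost_comp (cost_reindex (fun t1 => (t1, t2))) H1).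
have K2 : forall u1 : U1, cost N2
    (fun (b : T2 * U1 -> F) => lin M2 (fun t2 => b (t2, u1))).
  by move=> u1; exact: (cost_comp (cost_reindex (fun t2 => (t2, u1))) H2).
apply: (sub_cost (cost_comp (cost_family K1) (cost_family K2))) => // a [u1 u2] /=.
rewrite /lin /=.
transitivity (\sum_t2 \sum_t1 a (t1, t2) * (M1 t1 u1 * M2 t2 u2)).
  by apply: eq_bigr => t2 _; rewrite mulr_suml; apply: eq_bigr => t1 _; rewrite mulrA.
by rewrite exchange_big pair_big; apply: eq_bigr => -[].
Qed.

Lemma mulord_subproof n q (i : 'I_n) (d : 'I_q) : (i * q + d < q * n)%N.
Proof.
rewrite [ltnRHS]mulnC; apply: leq_trans (leq_mul (ltn_ord i) (leqnn q)).
by rewrite mulSn addnC ltn_add2r.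
Qed.

(** The index i * q + d splits an index below q * n into a quotient and a remainder;
    the product is written q * n to agree with [expnS]. *)
Definition mulord n q (i : 'I_n) (d : 'I_q) : 'I_(q * n) :=
  Ordinal (mulord_subproof i d).

Lemma divord_subproof n q (k : 'I_(q * n)) : (k %/ q < n)%N.
Proof.
have q0 : (0 < q)%N by case: q k => [[k]|].
by rewrite ltn_divLR // (mulnC n q).
Qed.

Definition divord n q (k : 'I_(q * n)) : 'I_n := Ordinal (divord_subproof k).

Lemma modord_subproof n q (k : 'I_(q * n)) : (k %% q < q)%N.
Proof. by rewrite ltn_mod; case: q k => [[k]|]. Qed.

Definition modord n q (k : 'I_(q * n)) : 'I_q := Ordinal (modord_subproof k).

Lemma mulordK n q (k : 'I_(q * n)) : mulord (divord k) (modord k) = k.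
Proof. by apply: val_inj; rewrite /= -divn_eq. Qed.

Lemma divordK n q (i : 'I_n) (d : 'I_q) : divord (mulord i d) = i.
Proof.
have q0 : (0 < q)%N by case: q d => [[k]|].
by apply: val_inj; rewrite /= divnMDl // divn_small // addn0.
Qed.

Lemma modordK n q (i : 'I_n) (d : 'I_q) : modord (mulord i d) = d.
Proof. by apply: val_inj; rewrite /= modnMDl modn_small. Qed.

Lemma sum_mulord n q (G : 'I_(q * n) -> F) :
  \sum_k G k = \sum_i \sum_d G (mulord i d).
Proof.
rewrite pair_big /= (reindex (fun x : 'I_n * 'I_q => mulord x.1 x.2)) //=.
exists (fun k => (divord k, modord k)) => [[i d] _|k _] /=.
  by rewrite divordK modordK.
exact: mulordK.
Qed.

(** Cooley-Tukey: for n = 2^r the transform of length 2 n at k is E + w^k O, where E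
    and O are the transforms with w^2 of the even and of the odd entries.  Both have
    period n in k because (w^2)^n = 1.  The recursion
    T(2 n) = 2 T(n) + 3 (2 n) gives T(2^r) = 3 r 2^r. *)
Lemma cost_fft r (w : F) : w ^+ (2 ^ r) = 1 ->
  cost (3 * r * 2 ^ r) (lin (fun j k : 'I_(2 ^ r) => w ^+ (j * k))).
Proof.
elim: r w => [|r IH] w w1.
  apply: (sub_cost (cost_reindex id)) => // a u /=.
  rewrite /lin big_ord_recl big_ord0 addr0 mul0n expr0 mulr1; congr a.
  by rewrite [u]ord1; apply: val_inj.
set n := (2 ^ r)%N; have w2 : (w ^+ 2) ^+ n = 1 by rewrite -exprM -expnS.
rewrite expnS -/n.
have half (d : 'I_2) : cost (3 * r * n) (fun a : 'I_(2 * n) -> F =>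
    lin (fun j k : 'I_n => (w ^+ 2) ^+ (j * k)) (fun i => a (mulord i d))).
  exact: (cost_comp (cost_reindex (fun i => mulord i d)) (IH _ w2)).
have n0 : (0 < n)%N by rewrite expn_gt0.
pose md (k : 'I_(2 * n)) : 'I_n := Ordinal (ltn_pmod k n0).
have join (k : 'I_(2 * n)) : scost 3 (fun b : 'I_2 * 'I_n -> F =>
    b (0, md k) + w ^+ k * b (1, md k)).
  exact: (scost_add (scost_var (0 : 'I_2, md k))
    (scost_mul (scost_const (w ^+ k)) (scost_var (1 : 'I_2, md k)))).
have := cost_comp (cost_family half) (cost_pointwise join).
rewrite !card_ord => H; apply: (sub_cost H) => [|a k /=].
  by apply: eq_leq; ring.
rewrite /lin sum_mulord exchange_big big_ord_recl big_ord1 /=.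
have red (i : 'I_n) : (w ^+ 2) ^+ (i * (k %% n)) = w ^+ (i * 2 * k).
  have -> : (i * 2 * k = 2 * (n * (i * (k %/ n)) + i * (k %% n)))%N.
    by rewrite {1}(divn_eq k n); ring.
  by rewrite [RHS]exprM exprD [_ ^+ (n * _)]exprM w2 expr1n mul1r.
congr (_ + _); first by apply: eq_bigr => i _; rewrite red addn0.
rewrite mulr_sumr; apply: eq_bigr => i _.
rewrite (_ : lift ord0 ord0 = 1); last exact: val_inj.
by rewrite red mulnDl mul1n exprD mulrCA [w ^+ k * _]mulrC.
Qed.

Lemma sum_root1 n (x : F) : x ^+ n = 1 -> x != 1 -> \sum_(h < n) x ^+ h = 0.
Proof.
move=> xn x1; have := subrX1 x n; rewrite xn subrr => /esym/eqP.
by rewrite mulf_eq0 subr_eq0 (negPf x1) => /eqP.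
Qed.

(** Any function on {0, ..., n-1} is a trigonometric polynomial; its coefficients are
    constants as far as operation counts are concerned. *)
Lemma fourier_coef n (z : F) (v : nat -> F) : n.-primitive_root z ->
  exists V : 'I_n -> F, forall t, (t < n)%N -> v t = \sum_h V h * z ^+ (t * h).
Proof.
move=> zP; have n0 := prim_root_natf_neq0 zP; have zn := prim_expr_order zP.
have z0 : z != 0.
  by apply: contra_eq_neq zn => ->; rewrite expr0n gtn_eqF ?(prim_order_gt0 zP) // eq_sym oner_eq0.
exists (fun h => n%:R^-1 * \sum_(t < n) v t * (z ^+ t)^-1 ^+ h) => t tn.
under eq_bigr => h _ do rewrite -mulrA mulr_suml.
rewrite -mulr_sumr exchange_big /= (bigD1 (Ordinal tn)) //= [X in _ + X]big1.
  rewrite addr0; under eq_bigr => h _ do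
    rewrite exprM -mulrA -exprMn mulVf ?expf_neq0 // expr1n mulr1.
  by rewrite sumr_const card_ord -[v t *+ n]mulr_natl mulKf.
move=> i it; under eq_bigr => h _ do rewrite exprM -mulrA -exprMn.
rewrite -mulr_sumr sum_root1 ?mulr0 //.
  by rewrite exprMn exprVn -!exprM ![(_ * n)%N]mulnC !exprM zn !expr1n invr1 mulr1.
rewrite mulrC -subr_eq0 -[1](divff (expf_neq0 i z0)) -mulrBl mulf_eq0.
rewrite negb_or invr_eq0 expf_neq0 // andbT subr_eq0 (eq_prim_root_expr zP).
by rewrite eq_sym !modn_small.
Qed.

Lemma bin2D j k : 'C(j + k, 2) = ('C(j, 2) + 'C(k, 2) + j * k)%N.
Proof.
elim: k => [|k IH]; first by rewrite addn0 muln0 !addn0.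
by rewrite addnS !binS !bin1 IH mulnS; ring.
Qed.

(** With v_t = w^'C(t, 2) and u_j = a_j / v_j, the chirp identity [bin2D] gives
      sum_j a_j w^(j k) = v_k^-1 sum_j u_j v_(j + k).
    Expand v_t = sum_h V_h z^(t h) for t < n = 2^r.  As j + k < 2 p <= n, the inner
    sum is sum_h V_h z^(h k) (sum_j u_j z^(j h)): a radix-2 transform of u padded by
    zeros, a multiplication by the constants V_h, and a second radix-2 transform. *)
Lemma cost_bluestein p r (z w : F) :
  (2 ^ r).-primitive_root z -> w != 0 -> (2 * p <= 2 ^ r)%N ->
  cost (6 * r * 2 ^ r + 4 * 2 ^ r + 2 * p)
    (lin (fun j k : 'I_p => w ^+ (j * k))).
Proof.
set n := (2 ^ r)%N => zP w0 pn.
have [V VE] := fourier_coef (fun t => w ^+ 'C(t, 2)) zP.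
have len : (p <= n)%N by apply: leq_trans pn; rewrite mul2n -addnn leq_addr.
pose u (j : 'I_n) (a : 'I_p -> F) : F :=
  if insub (val j) is Some i then (w ^+ 'C(j, 2))^-1 * a i else 0.
have pad (j : 'I_n) : scost 2 (u j).
  rewrite /u; case: insub => [i|]; last exact: (sub_cost (scost_const _)).
  exact: (scost_mul (scost_const _) (scost_var i)).
have fft := cost_fft (prim_expr_order zP).
(* Padding and pre-multiplication, transform, multiplication by V, transform,
   truncation to the first p entries, post-multiplication. *)
have H := cost_comp (cost_comp (cost_comp (cost_comp (cost_comp
   (cost_pointwise pad) fft) (cost_scale V)) fft)
   (cost_reindex (widen_ord len)))
   (cost_scale (fun k : 'I_p => (w ^+ 'C(k, 2))^-1)).
rewrite !card_ord in H; apply: (sub_cost H) => [|a k /=].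
  by apply: eq_leq; rewrite -/n; ring.
rewrite /lin /=.
under eq_bigr => h _ do rewrite mulr_sumr mulr_suml.
rewrite exchange_big /= mulr_sumr.
transitivity (\sum_(j < n) (w ^+ 'C(k, 2))^-1 * (u j a * w ^+ 'C(j + k, 2))).
  apply: eq_bigr => j _; have [jp|jp] := ltnP j p; last first.
    rewrite /u insubF ?ltnNge ?jp // mul0r mulr0 big1 ?mulr0 // => h _.
    by rewrite mul0r mulr0 mul0r.
  have jkn : (j + k < n)%N.
    apply: leq_trans pn; rewrite mul2n -addnn -addnS; apply: leq_add => //.
    exact: ltnW.
  rewrite (VE _ jkn) mulr_sumr; congr (_ * _); apply: eq_bigr => h _.
  rewrite mulnDl exprD [(h * k)%N]mulnC; ring.
rewrite (bigID (fun j : 'I_n => (j < p)%N)) /= [X in _ + X]big1 => [|j /negPf jp].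
  rewrite addr0 (big_ord_narrow len); apply: eq_bigr => j _.
  rewrite /u (_ : insub _ = Some j); last exact: (valK j).
  by rewrite bin2D !exprD; field; rewrite !expf_neq0.
by rewrite /u insubF ?jp // mul0r mulr0.
Qed.

(** The character matrix of 'F_p^m in terms of indices.  The arguments are plain
    numbers, so that [expnS] can be rewritten in the types of the indices. *)
Definition dotpow p m (w : F) (n h : nat) : F :=
  w ^+ (\sum_(i < m) ndigit p n i * ndigit p h i)%N.

(** The lowest digit splits off: the matrix for m + 1 is the tensor product of the
    one for m with the one-dimensional one, and (m p^m b) p + p^m (p b) =
    (m + 1) p^(m + 1) b. *)
Lemma cost_multidim p b (w : F) :
  cost (p * b) (lin (fun j k : 'I_p => w ^+ (j * k))) ->
  forall m, cost (m * p ^ m * b) (lin (fun n h : 'I_(p ^ m) => dotpow p m w n h)).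
Proof.
move=> H; elim=> [|m IH].
  apply: (sub_cost (cost_reindex id)) => // a u /=.
  rewrite /lin big_ord_recl big_ord0 addr0 /dotpow big_ord0 expr0 mulr1.
  by rewrite [u]ord1; congr a; apply: val_inj.
rewrite expnS.
pose enc (x : 'I_(p ^ m) * 'I_p) := mulord x.1 x.2.
pose dec (k : 'I_(p * p ^ m)) : 'I_(p ^ m) * 'I_p := (divord k, modord k).
have := cost_comp (cost_comp (cost_reindex enc) (cost_tensor IH H))
  (cost_reindex dec).
rewrite !card_ord => H'; apply: (sub_cost H') => [|a k /=].
  by apply: eq_leq; ring.
rewrite /lin sum_mulord pair_big /=; apply: eq_bigr => -[i d] _ /=.
congr (_ * _); rewrite /dotpow big_ord_recl exprD mulrC !ndigit0 /=.
rewrite modnMDl (modn_small (ltn_ord d)); congr (_ * _ ^+ _).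
apply: eq_bigr => l _; rewrite !ndigitS /=.
by have := divordK i d => /(congr1 val) /= ->.
Qed.

End FastTransforms.

(** * Complex roots of unity *)

Section RootOfUnity.
Variable R : realType.

Lemma omegaX n d : omega n R ^+ d =
  cos (2 * pi / n%:R * d%:R) +i* sin (2 * pi / n%:R * d%:R).
Proof.
elim: d => [|d IH]; first by rewrite mulr0 cos0 sin0.
rewrite exprSr IH /omega -[d.+1%:R]natr1 (mulrDr _ d%:R) mulr1 cosD sinD; simpc.
by congr (_ +i* _); rewrite addrC [sin _ * cos _]mulrC.
Qed.

Lemma omega_order n : (0 < n)%N -> omega n R ^+ n = 1.
Proof.
move=> n0; rewrite omegaX mulfVK ?pnatr_eq0 -?lt0n //.
by rewrite mulr_natl cos2pi sin2pi.
Qed.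

(** If omega^e = 1 with 0 < e <= n / 2, the angle 2 pi e / n lies in (0, pi] and has
    cosine 1, contrary to the injectivity of cos on [0, pi].  An exponent e > n / 2
    reduces to n - e. *)
Lemma omega_prim n : (0 < n)%N -> n.-primitive_root (omega n R).
Proof.
move=> n0; have on := omega_order n0.
have half e : (0 < e)%N -> (e.*2 <= n)%N -> omega n R ^+ e != 1.
  move=> e0 en; apply/negP => /eqP; rewrite omegaX => -[c1 _].
  have n0' : 0 < n%:R :> R by rewrite ltr0n.
  have e0' : 0 < e%:R :> R by rewrite ltr0n.
  have en' : e%:R * 2 <= n%:R :> R by rewrite -natrM muln2 ler_nat.
  have x0 : 0 < 2 * pi / n%:R * e%:R :> R.
    by rewrite !mulr_gt0 ?invr_gt0 ?pi_gt0.
  have xpi : 2 * pi / n%:R * e%:R <= pi :> R.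
    rewrite mulrAC ler_pdivrMr //; have := ler_wpM2l (pi_ge0 R) en'; lra.
  have := @cos_inj R (2 * pi / n%:R * e%:R) 0.
  rewrite !in_itv /= lexx pi_ge0 (ltW x0) xpi c1 cos0 => /(_ isT isT erefl) x00.
  by rewrite x00 ltxx in x0.
apply/andP; split=> //; apply/forallP => i; apply/eqP.
rewrite unity_rootE; case: (eqVneq i.+1 n) => [->|ni]; first by rewrite on eqxx.
have {}ni : (i.+1 < n)%N by rewrite ltn_neqAle ni /=.
apply/negbTE; have [le|lt] := leqP (i.+1).*2 n; first exact: half.
have ei : omega n R ^+ i.+1 * omega n R ^+ (n - i.+1) = 1.
  by rewrite -exprD subnKC // ltnW.
apply/negP => /eqP e1; move: ei; rewrite e1 mul1r; apply/eqP/half.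
  by rewrite subn_gt0.
by rewrite doubleB leq_subLR -[n.*2]addnn leq_add2r ltnW.
Qed.

Lemma omega_conj n : omega n R * (omega n R)^*%R = 1.
Proof.
rewrite /omega; apply/eqP; rewrite eq_complex /=; apply/andP; split; apply/eqP.
  by rewrite mulrN opprK -!expr2 cos2Dsin2.
by rewrite mulrN mulrC addNr.
Qed.

End RootOfUnity.

(** * Fourier analysis on the index group and Walsh functions at net points *)

Section Character.
Variables (R : realType) (p : nat).
Hypothesis pP : prime p.

Let p1 : (1 < p)%N := prime_gt1 pP.
Let p0 : (0 < p)%N := prime_gt0 pP.

Definition chi (a : 'F_p) : R[i] := omega p R ^+ a.

Lemma chi_nat k : chi k%:R = omega p R ^+ k.
Proof. by rewrite /chi val_Fp_nat // expr_mod // omega_order. Qed.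

Lemma chi0 : chi 0 = 1. Proof. exact: expr0. Qed.

Lemma chiD a b : chi (a + b) = chi a * chi b.
Proof. by rewrite -[a]natr_Zp -[b]natr_Zp -natrD !chi_nat exprD. Qed.

Lemma omega_neq0 : omega p R != 0.
Proof.
apply: contra_eq_neq (omega_order R p0) => ->.
by rewrite expr0n gtn_eqF // eq_sym oner_eq0.
Qed.

Lemma chi_neq0 a : chi a != 0.
Proof. by rewrite expf_neq0 // omega_neq0. Qed.

Lemma chiN a : chi (- a) = (chi a)^-1.
Proof.
by apply: (mulfI (chi_neq0 a)); rewrite -chiD subrr chi0 divff ?chi_neq0.
Qed.

Lemma chi_conj a : (chi a)^*%R = chi (- a).
Proof.
rewrite chiN; apply: (mulfI (chi_neq0 a)); rewrite divff ?chi_neq0 //.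
by rewrite rmorphXn -exprMn omega_conj expr1n.
Qed.

Lemma chi_sum (I : Type) (r : seq I) (P : pred I) (F : I -> 'F_p) :
  chi (\sum_(i <- r | P i) F i) = \prod_(i <- r | P i) chi (F i).
Proof. exact: (big_morph chi chiD chi0). Qed.

Lemma chi1_neq1 : chi 1 != 1.
Proof.
rewrite (chi_nat 1 : chi 1 = _) -[X in _ != X](expr0 (omega p R)).
by rewrite (eq_prim_root_expr (omega_prim R p0)) mod0n modn_small.
Qed.

Definition dot m (u v : 'cV['F_p]_m) : 'F_p := (u^T *m v) 0 0.

Lemma dotE m (u v : 'cV['F_p]_m) : dot u v = \sum_i u i 0 * v i 0.
Proof. by rewrite /dot mxE; apply: eq_bigr => i _; rewrite mxE. Qed.

Lemma dotC m (u v : 'cV['F_p]_m) : dot u v = dot v u.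
Proof. by rewrite !dotE; apply: eq_bigr => i _; rewrite mulrC. Qed.

Lemma dotDl m (u v w : 'cV['F_p]_m) : dot (u + v) w = dot u w + dot v w.
Proof. by rewrite /dot linearD mulmxDl mxE. Qed.

Lemma dotNl m (u w : 'cV['F_p]_m) : dot (- u) w = - dot u w.
Proof. by rewrite /dot linearN mulNmx mxE. Qed.

Lemma dotDr m (u v w : 'cV['F_p]_m) : dot u (v + w) = dot u v + dot u w.
Proof. by rewrite /dot mulmxDr mxE. Qed.

Lemma dotNr m (u w : 'cV['F_p]_m) : dot u (- w) = - dot u w.
Proof. by rewrite /dot mulmxN mxE. Qed.

Lemma dot0 m (u : 'cV['F_p]_m) : dot u 0 = 0.
Proof. by rewrite /dot mulmx0 mxE. Qed.

Lemma card_cV m : #|{: 'cV['F_p]_m}| = (p ^ m)%N.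
Proof. by rewrite card_mx card_Fp // muln1. Qed.

(** If h is nonzero, some e has dot e h = 1.  Translating the summation index by e
    multiplies the sum by chi 1, which differs from 1. *)
Lemma sum_chi m (h : 'cV['F_p]_m) :
  \sum_u chi (dot u h) = if h == 0 then p%:R ^+ m else 0.
Proof.
case: eqVneq => [->|h0].
  under eq_bigr => u _ do rewrite dot0 chi0.
  by rewrite sumr_const card_cV natrX.
have [i hi] : exists i, h i 0 != 0.
  apply/existsP; apply: contraNT h0 => /existsPn H; apply/eqP/matrixP => i j.
  by rewrite [j]ord1 mxE; apply/eqP; have := H i; rewrite negbK.
pose e : 'cV['F_p]_m := (h i 0)^-1 *: delta_mx i 0.
have eh : dot e h = 1.
  rewrite dotE (bigD1 i) //= big1 ?addr0 => [|j ji].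
    by rewrite !mxE !eqxx mulr1 mulVf.
  by rewrite !mxE (negPf ji) mulr0 mul0r.
apply/eqP; rewrite -[_ == 0]orFb -(negPf chi1_neq1) -subr_eq0 -mulf_eq0.
rewrite mulrBl mul1r subr_eq0 mulr_sumr eq_sym (reindex_inj (addrI e)) /=.
by apply/eqP/eq_bigr => u _; rewrite dotDl chiD eh.
Qed.

Section Indices.
Variable m : nat.

Definition dvec (n : 'I_(p ^ m)) : 'cV['F_p]_m := digitvec p m n.

Lemma digitvecE k i : (digitvec p m k i 0 : nat) = ndigit p k i.
Proof. by rewrite mxE val_Fp_nat // modn_mod. Qed.

Lemma dvec_inj : injective dvec.
Proof.
move=> n l e; apply/val_inj/(ndigit_inj p1) => i; have [im|mi] := ltnP i m.
  by have /(congr1 (fun v : 'cV_m => nat_of_ord (v (Ordinal im) 0))) := e; rewrite !digitvecE.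
have lep : (p ^ m <= p ^ i)%N by rewrite leq_exp2l.
by rewrite !ndigit_small ?(leq_trans (ltn_ord _) lep).
Qed.

Lemma dvec_bij : bijective dvec.
Proof. by apply: inj_card_bij dvec_inj _; rewrite card_cV card_ord. Qed.

Lemma sum_dvec (G : 'cV['F_p]_m -> R[i]) : \sum_n G (dvec n) = \sum_u G u.
Proof. by rewrite [RHS](reindex dvec) //; apply: onW_bij dvec_bij. Qed.

(** The Fourier transform on 'F_p^m of a function given on the indices of the net;
    [dwtE] identifies it with the discrete Walsh transform. *)
Definition fourier (g : 'I_(p ^ m) -> R[i]) (h : 'cV['F_p]_m) : R[i] :=
  (p%:R ^+ m)^-1 * \sum_n g n * chi (- dot (dvec n) h).

Lemma pm_neq0 : p%:R ^+ m != 0 :> R[i].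
Proof. by rewrite expf_neq0 // pnatr_eq0 -lt0n. Qed.

Lemma fourierK a h : fourier (fun n => \sum_h a h * chi (dot (dvec n) h)) h = a h.
Proof.
rewrite /fourier; under eq_bigr => n _ do rewrite mulr_suml.
rewrite exchange_big (bigD1 h) //= [X in _ + X]big1 => [|l lh].
  under eq_bigr => n _ do rewrite -mulrA -chiD subrr chi0 mulr1.
  by rewrite sumr_const card_ord addr0 -[a h *+ _]mulr_natl natrX mulKf ?pm_neq0.
under eq_bigr => n _ do rewrite -mulrA -chiD -dotNr -dotDr.
rewrite -mulr_sumr (sum_dvec (fun u => chi (dot u (l - h)))) sum_chi subr_eq0.
by rewrite (negPf lh) mulr0.
Qed.

Lemma fourier_inv g n : \sum_h fourier g h * chi (dot (dvec n) h) = g n.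
Proof.
rewrite /fourier; under eq_bigr => h _ do rewrite -mulrA mulr_suml.
rewrite -mulr_sumr exchange_big (bigD1 n) //= [X in _ + X]big1 => [|l ln].
  under eq_bigr => h _ do rewrite -mulrA -chiD addNr chi0 mulr1.
  by rewrite sumr_const card_cV addr0 -[g n *+ _]mulr_natl natrX mulKf ?pm_neq0.
under eq_bigr => h _ do rewrite -mulrA -chiD addrC -dotNl -dotDl dotC.
rewrite -mulr_sumr sum_chi subr_eq0 (inj_eq dvec_inj) eq_sym.
by rewrite (negPf ln) mulr0.
Qed.

Lemma fourier_lin g (h : 'I_(p ^ m)) : fourier g (dvec h) =
  (p%:R ^+ m)^-1 * lin (fun n h : 'I_(p ^ m) => dotpow p m (omega p R)^-1 n h) g h.
Proof.
congr (_ * _); apply: eq_bigr => n _; congr (_ * _); rewrite /dotpow exprVn chiN.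
congr (_^-1); rewrite dotE -chi_nat natr_sum; congr chi; apply: eq_bigr => i _.
by rewrite natrM !mxE.
Qed.

Lemma inv_fourier_lin a (n : 'I_(p ^ m)) : \sum_h a h * chi (dot (dvec n) h) =
  lin (fun h n : 'I_(p ^ m) => dotpow p m (omega p R) h n) (fun h => a (dvec h)) n.
Proof.
rewrite -(sum_dvec (fun h => a h * chi (dot (dvec n) h))); apply: eq_bigr => h _.
congr (_ * _); rewrite /dotpow dotC dotE -chi_nat natr_sum; congr chi.
by apply: eq_bigr => i _; rewrite natrM !mxE.
Qed.

(** A Walsh function evaluated at a digit sequence that vanishes from place m on is a
    character value.  The digits of x_n (-) x_v are produced by a reduction modulo p,
    hence the condition on [d i %% p]. *)
Lemma wal_digitsE k (d : nat -> nat) (u : 'cV['F_p]_m) :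
  (forall i : 'I_m, (d i)%:R = u i 0) -> (forall i, (m <= i)%N -> (d i %% p = 0)%N) ->
  wal_digits p R k d = chi (dot u (digitvec p m k)).
Proof.
move=> du d0; rewrite /wal_digits -chi_nat natr_sum dotE.
rewrite (eq_bigr (fun i : 'I__ => (d i %% p * ndigit p k i)%N%:R)); last first.
  by move=> i _; rewrite !natrM -[in RHS]Fp_nat_mod // modn_mod Fp_nat_mod.
rewrite -natr_sum (sum_nat_support (N := nu p k) (M := m)
  (F := fun i => (d i %% p * ndigit p k i)%N)) => [|i ki|i mi].
- rewrite natr_sum; congr chi; apply: eq_bigr => i _.
  by rewrite mxE -du natrM Fp_nat_mod.
- by rewrite ndigit_nu ?muln0.
- by rewrite d0.
Qed.

End Indices.

Section Net.
Variables (s m : nat) (C : 'I_s -> 'M['F_p]_m).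

(** The sum that defines a coordinate of x_n is its base p expansion, followed by
    zeros. *)
Lemma netpoint_digits (n : 'I_(p ^ m)) j :
  0 <= (netpoint C R n) 0 j < 1 /\
  forall i, rdigit p ((netpoint C R n) 0 j) i =
    oapp (fun i => (C j *m dvec n) i 0 : nat) 0%N (insub i).
Proof.
pose y i := oapp (fun i : 'I_m => (C j *m dvec n) i 0 : nat) 0%N (insub i).
have yp i : (y i < p)%N.
  rewrite /y; case: insub => //= l; have := ltn_ord ((C j *m dvec n) l 0).
  by rewrite [X in (_ < X)%N]Fp_cast.
have xE : (netpoint C R n) 0 j = \sum_(i < m) (y i)%:R / p%:R ^+ i.+1.
  by rewrite mxE; apply: eq_bigr => i _; rewrite /y valK.
have [H1 H2] := rdigit_sum p1 yp xE; split=> // i; rewrite H2 /y.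
by case: ltnP => // mi; rewrite insubF // ltnNge mi.
Qed.

Lemma cube_netpoint n : cube (netpoint C R n).
Proof. by move=> j; have [] := netpoint_digits n j. Qed.

Lemma dot_netdot (u : 'cV['F_p]_m) k : dot u (netdot C k) =
  \sum_j dot (C j *m u) (digitvec p m (tnth k j)).
Proof.
rewrite /dot /netdot mulmx_sumr summxE; apply: eq_bigr => j _.
by rewrite trmx_mul mulmxA.
Qed.

Lemma wal_netpoint k n : wal p k (netpoint C R n) = chi (dot (dvec n) (netdot C k)).
Proof.
rewrite dot_netdot chi_sum; apply: eq_bigr => j _; apply: wal_digitsE => i.
  by rewrite (netpoint_digits n j).2 valK /= natr_Zp.
by move=> mi; rewrite (netpoint_digits n j).2 insubF ?mod0n // ltnNge mi.
Qed.

Lemma wal_osub_netpoint k n v : wal_osub p k (netpoint C R n) (netpoint C R v) =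
  chi (dot (dvec n - dvec v) (netdot C k)).
Proof.
rewrite dot_netdot chi_sum; apply: eq_bigr => j _; apply: wal_digitsE => i.
  rewrite /dsub !(netpoint_digits _ j).2 !valK /= Fp_nat_mod // natrD natrB.
    by rewrite pchar_Fp_0 // sub0r !natr_Zp mulmxBr !mxE.
  have := ltn_ord ((C j *m dvec v) i 0); rewrite [X in (_ < X)%N]Fp_cast //.
  exact: ltnW.
move=> mi; rewrite /dsub !(netpoint_digits _ j).2 insubF ?ltnNge ?mi //=.
by rewrite add0n subn0 modnn mod0n.
Qed.

Lemma dwtE g k : dwt C g k = fourier g (netdot C k).
Proof.
by congr (_ * _); apply: eq_bigr => n _; rewrite wal_netpoint chi_conj.
Qed.

Lemma netdot_wadd k l : netdot C (wadd p k l) = netdot C k + netdot C l.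
Proof.
rewrite /netdot -big_split; apply: eq_bigr => j _ /=; rewrite -mulmxDr.
congr (_ *m _); apply/matrixP => i o; rewrite !mxE tnth_mktuple ndigit_nadd //.
by rewrite Fp_nat_mod // natrD.
Qed.

(** Digitwise addition of k, iterated p times, is the identity; this makes it a
    bijection whose inverse is its (p-1)-st iterate.  It sends the dual net to the
    coset of C . k because the net product is additive. *)
Lemma wadd_bij k : set_bij (dual_net C) (coset_net C (netdot C k)) (wadd p k).
Proof.
have iterE e l i j : ndigit p (tnth (iter e (wadd p k) l) j) i =
    ((e * ndigit p (tnth k j) i + ndigit p (tnth l j) i) %% p)%N.
  elim: e => [|e IH] /=; first by rewrite mul0n add0n modn_small ?ndigit_lt.
  by rewrite tnth_mktuple ndigit_nadd // IH modnDmr mulSn addnA.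
have iterK l : iter p (wadd p k) l = l.
  apply: eq_from_tnth => j; apply: (ndigit_inj p1) => i.
  by rewrite iterE mulnC modnMDl modn_small ?ndigit_lt.
have iter1 l : iter p.-1 (wadd p k) (wadd p k l) = l.
  by rewrite -iterSr prednK.
split=> [l|l l' _ _|l].
- by rewrite /dual_net /coset_net /= netdot_wadd => ->; rewrite addr0.
- by move=> e; rewrite -[l]iter1 e iter1.
- rewrite /coset_net /= => lk; exists (iter p.-1 (wadd p k) l).
    apply: (addrI (netdot C k)).
    by rewrite -netdot_wadd -iterS prednK // iterK lk addr0.
  by rewrite -iterS prednK // iterK.
Qed.

End Net.
End Character.

(** * The kernel at net points *)

Section NonnegSums.
Variables (R : realType) (T : choiceType).

(** The partial sums are nondecreasing in the finite set, so they approach their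
    supremum along the filter of finite sets. *)
Lemma cvg_partial_sumT (b : T -> R) : (forall k, 0 <= b k) ->
  (\esum_(k in [set: T]) (b k)%:E)%E \is a fin_num ->
  partial_sum (b : T -> R^o) @ totally --> fine (\esum_(k in [set: T]) (b k)%:E)%E.
Proof.
have FF := @totally_filter T.
move=> b0 fin; apply/cvgrPdist_le => e e0.
have [x [X [finX _] xE] lt] := ub_ereal_sup_adherent e0 fin.
exists (fset_set X) => // A /= XA.
have pE : partial_sum (b : T -> R^o) A = \sum_(k <- A) b k by rewrite big_seq_fsetE.
have up : ((\sum_(k <- A) b k)%:E <= \esum_(k in [set: T]) (b k)%:E)%E.
  apply: esum_ge; exists [set` A]; first by split.
  by rewrite fsbig_finite // set_fsetK sumEFin.
have lo : (x <= (\sum_(k <- A) b k)%:E)%E.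
  rewrite -xE fsbig_finite // -sumEFin; apply: lee_sum_nneg_subfset => //.
    by move=> k kX; apply: (fsubsetP XA).
  by move=> k _ _; rewrite lee_fin.
have := lt_le_trans lt lo; move: up; rewrite -/(esum _ _) -(fineK fin) pE.
rewrite -EFinB lee_fin lte_fin => up {}lo.
by rewrite ger0_norm ?subr_ge0 // lerBlDr addrC -lerBlDr ltW.
Qed.

Lemma cvg_partial_sum (a : T -> R) (D : set T) : (forall k, 0 <= a k) ->
  esum.summable [set: T] (fun k => (a k)%:E) ->
  partial_sum (fun k => (if k \in D then a k else 0) : R^o) @ totally -->
    fine (\esum_(k in D) (a k)%:E)%E.
Proof.
move=> a0 sa; rewrite esum_mkcond.
have -> : (fun k => if k \in D then (a k)%:E else 0%E) =
    (fun k => (if k \in D then a k else 0)%:E).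
  by apply/funext => k; case: ifP.
apply: cvg_partial_sumT => [k|]; first by case: ifP.
rewrite fin_numElt; apply/andP; split.
  by apply: lt_le_trans (ltNyr 0) _; apply: esum_ge0 => k _; case: ifP; rewrite lee_fin.
apply: le_lt_trans sa; apply: le_esum => k _; rewrite abse_EFin lee_fin.
by case: ifP => _; rewrite ?normr_ge0 // ler_norm.
Qed.

Lemma cvg_complex (F : set_system T) (FF : Filter F) (f : T -> R) (l : R) :
  f @ F --> (l : R^o) -> ((f x)%:C : R[i]^o) @[x --> F] --> (l%:C : R[i]^o).
Proof.
move=> /cvgrPdist_lt H; apply/cvgrPdist_lt => -[e e'] /=.
rewrite ltcE /= => /andP[/eqP-> e0].
apply: filterS (H e e0) => x; rewrite -rmorphB normc_def /= expr0n addr0.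
by rewrite sqrtr_sqr ltcR.
Qed.

End NonnegSums.

Section Kernel.
Variables (R : realType) (p : nat).
Hypothesis pP : prime p.
Variables (s m : nat) (C : 'I_s -> 'M['F_p]_m) (Khat : s.-tuple nat -> R)
  (K : 'rV[R]_s -> 'rV[R]_s -> R[i]).
Hypothesis Khat0 : forall k, 0 <= Khat k.
Hypothesis Khat_sum : esum.summable [set: s.-tuple nat] (fun k => (Khat k)%:E).
Hypothesis KW : walsh_kernel p Khat K.

(** The eigenvalues of the interpolation matrix, up to the factor p^m. *)
Definition kappa (h : 'cV['F_p]_m) : R :=
  fine (\esum_(k in coset_net C h) (Khat k)%:E)%E.

Lemma KtildeE k : Ktilde C Khat k = kappa (netdot C k).
Proof. by rewrite /kappa (reindex_esum _ _ _ _ (wadd_bij pP C k)). Qed.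

(** A finite partial sum of the kernel series splits according to the coset of the
    wavenumber, on which the Walsh function is constant; each of the p^m pieces
    converges to the sum over its coset. *)
Lemma kernel_netpoint n v : K (netpoint C R n) (netpoint C R v) =
  \sum_h (kappa h)%:C * chi R (dot (dvec n - dvec v) h).
Proof.
have FF := @totally_filter (s.-tuple nat).
have [_ KE] := KW (cube_netpoint R pP C n) (cube_netpoint R pP C v).
apply: (cvg_unique (@norm_hausdorff _ R[i]^o) KE).
have -> : partial_sum (fun k => (Khat k)%:C *
      wal_osub p k (netpoint C R n) (netpoint C R v) : R[i]^o) =
    (fun A => \sum_h (partial_sum (fun k =>
        (if k \in coset_net C h then Khat k else 0) : R^o) A)%:C *
      chi R (dot (dvec n - dvec v) h)).
  apply/funext => A; rewrite /partial_sum.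
  under [RHS]eq_bigr => h _ do rewrite rmorph_sum mulr_suml.
  rewrite exchange_big; apply: eq_bigr => k _ /=.
  rewrite (bigD1 (netdot C (val k))) //= big1 => [|h hk].
    by rewrite addr0 wal_osub_netpoint // ifT // inE.
  rewrite ifF ?mul0r //; apply/negbTE; rewrite notin_setE => /esym/eqP.
  exact/negP.
apply: cvg_big => [|h _]; first exact: add_continuous.
by apply: cvgMr_tmp; apply: cvg_complex; apply: cvg_partial_sum.
Qed.

Variables (f : 'rV[R]_s -> R[i]).
Implicit Type c : 'I_(p ^ m) -> R[i].

(** The separation chi (dot (n - v) h) = chi (dot n h) chi (- dot v h) makes the sum
    over v a Fourier coefficient of c. *)
Lemma spline_netpoint c n : spline C K c (netpoint C R n) =
  \sum_h p%:R ^+ m * (kappa h)%:C * fourier c h * chi R (dot (dvec n) h).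
Proof.
rewrite /spline; under eq_bigr => v _ do rewrite kernel_netpoint mulr_sumr.
rewrite exchange_big; apply: eq_bigr => h _ /=.
rewrite /fourier (mulrAC (p%:R ^+ m)) mulVKf ?pm_neq0 // !mulr_suml.
apply: eq_bigr => v _; rewrite dotDl dotNl chiD //; ring.
Qed.

Lemma fourier_interpolates c h : interpolates C K f c ->
  fourier (fun n => f (netpoint C R n)) h = p%:R ^+ m * (kappa h)%:C * fourier c h.
Proof.
move=> fc.
rewrite -[RHS](fourierK pP (fun h => p%:R ^+ m * (kappa h)%:C * fourier c h) h).
congr (_ * _).
by apply: eq_bigr => n _; rewrite fc spline_netpoint.
Qed.

(** If kappa h = 0, then c + chi (dot _ h) interpolates the same data as c but has
    another Fourier coefficient at h. *)
Lemma unique_kappa_neq0 c h : interpolates C K f c ->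
  (forall c', interpolates C K f c' -> c' =1 c) -> kappa h != 0.
Proof.
move=> fc uniq; apply/eqP => h0.
pose c' n := \sum_l (fourier c l + (l == h)%:R) * chi R (dot (dvec n) l).
have c'E l : fourier c' l = fourier c l + (l == h)%:R by rewrite fourierK.
have := c'E h; have -> : c' = c.
  apply/funext/uniq => n; rewrite fc !spline_netpoint; apply: eq_bigr => l _.
  rewrite c'E; case: eqP => [->|_]; last by rewrite addr0.
  by rewrite h0 mulr0 !mul0r.
by rewrite eqxx => /eqP; rewrite -subr_eq0 opprD addNKr oppr_eq0 oner_eq0.
Qed.

(** The column of the interpolation matrix at the origin is the inverse Fourier
    transform of its eigenvalues. *)
Lemma fourier_kernel (v0 : 'I_(p ^ m)) h : dvec v0 = 0 ->
  fourier (fun n => K (netpoint C R n) (netpoint C R v0)) h = (kappa h)%:C.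
Proof.
move=> v00; rewrite -[RHS](fourierK pP (fun h => (kappa h)%:C) h); congr (_ * _).
by apply: eq_bigr => n _; rewrite kernel_netpoint v00 subr0.
Qed.

End Kernel.

Section Origin.
Variables (R : realType) (p : nat).
Hypothesis pP : prime p.
Variables (s m : nat) (C : 'I_s -> 'M['F_p]_m).

Lemma pm_gt0 : (0 < p ^ m)%N. Proof. by rewrite expn_gt0 prime_gt0. Qed.

Definition ord_origin : 'I_(p ^ m) := Ordinal pm_gt0.

Lemma dvec_origin : dvec ord_origin = 0.
Proof.
by apply/matrixP => i j; rewrite !mxE /ndigit div0n mod0n.
Qed.

Lemma netpoint_origin : netpoint C R ord_origin = 0.
Proof.
apply/matrixP => i j; rewrite !mxE big1 // => l _.
by rewrite -/(dvec ord_origin) dvec_origin mulmx0 mxE mul0r.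
Qed.

End Origin.

(** * The program and the theorem *)

Section SplineProgram.
Variables (R : realType) (p : nat).
Hypothesis pP : prime p.

Let t := trunc_log 2 p.

Let t0 : (0 < t)%N.
Proof. by rewrite trunc_log_gt0 //= prime_gt1. Qed.

(** With 2^t <= p < 2^(t + 1) the radix-2 length 2^(t + 2) lies between 2 p and 4 p,
    and the count of [cost_bluestein] is at most 24 t p + 66 p <= 90 t p since
    t >= 1. *)
Lemma cost_dft_prime (w : R[i]) : w != 0 ->
  cost (p * (90 * t)) (lin (fun j k : 'I_p => w ^+ (j * k))).
Proof.
move=> w0.
have /andP[lo hi] := trunc_log_bounds (isT : (1 < 2)%N) (prime_gt0 pP).
have len : (2 * p <= 2 ^ t.+2)%N by rewrite expnS leq_mul2l /= ltnW.
have z : (2 ^ t.+2).-primitive_root (omega (2 ^ t.+2) R).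
  by apply: omega_prim; rewrite expn_gt0.
apply: (sub_cost (cost_bluestein z w0 len)) => //.
have n4 : (2 ^ t.+2 <= 4 * p)%N by rewrite !expnS mulnA leq_mul2l /=.
have tp : (p <= t * p)%N by rewrite leq_pmull.
apply: (@leq_trans (6 * t.+2 * (4 * p) + 4 * (4 * p) + 2 * p)).
  by rewrite leq_add2r leq_add // leq_mul2l n4 orbT.
apply: (@leq_trans (24 * (t * p) + 66 * p)); first by apply: eq_leq; ring.
apply: (@leq_trans (24 * (t * p) + 66 * (t * p))).
  by rewrite leq_add2l leq_mul2l tp orbT.
by apply: eq_leq; ring.
Qed.

Variable m : nat.
Let N := (p ^ m)%N.

Lemma cost_fourier : cost (m * N * (90 * t) + N * 2)
  (fun (g : 'I_(p ^ m) -> R[i]) u => fourier g (dvec u)).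
Proof.
have w0 : (omega p R)^-1 != 0 by rewrite invr_eq0 omega_neq0.
have H := cost_comp (cost_multidim (m := m) (cost_dft_prime w0))
  (cost_scale (fun _ : 'I_(p ^ m) => (p%:R ^+ m)^-1)).
apply: (sub_cost H) => [|g u]; first by rewrite card_ord.
by rewrite fourier_lin.
Qed.

Lemma cost_inv_fourier : cost (m * N * (90 * t))
  (fun (a : 'I_(p ^ m) -> R[i]) n =>
    lin (fun h n : 'I_(p ^ m) => dotpow p m (omega p R) h n) a n).
Proof. exact: (cost_multidim (m := m) (cost_dft_prime (omega_neq0 R pP))). Qed.

Let I : Type := ('I_(p ^ m) + 'I_(p ^ m) * 'I_(p ^ m))%type.

Definition data_hat (inp : I -> R[i]) (u : 'I_(p ^ m)) : R[i] :=
  fourier (fun n => inp (inl n)) (dvec u).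

Definition kernel_hat (inp : I -> R[i]) (u : 'I_(p ^ m)) : R[i] :=
  fourier (fun n => inp (inr (n, ord_origin pP m))) (dvec u).

Definition coef_hat (inp : I -> R[i]) (u : 'I_(p ^ m)) : R[i] :=
  data_hat inp u / (p%:R ^+ m * kernel_hat inp u).

(** Three transforms and 7 p^m further operations: 2 p^m for each normalization by
    p^-m of a forward transform, 2 p^m for multiplying kernel_hat by p^m, and p^m for
    the quotients.  A coefficient of the spline depends on all the quotients, hence
    its smaller domain. *)
Lemma spline_program : exists P : seq (instr R[i] I),
  [/\ (size P <= 3 * (m * N * (90 * t)) + 7 * N)%N,
      forall u, avail (fun _ => True) P (data_hat^~ u),
      forall u, avail (fun _ => True) P (kernel_hat^~ u),
      forall u, avail (fun inp => kernel_hat inp u != 0) P (coef_hat^~ u)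
    & forall n, avail (fun inp => forall u, kernel_hat inp u != 0) P
        (fun inp => lin (fun h n : 'I_(p ^ m) => dotpow p m (omega p R) h n)
                      (coef_hat inp) n)].
Proof.
have [|P1 s1 H1] := cost_fourier (D := fun _ : I -> R[i] => True) (P := [::])
  (a := fun n inp => inp (inl n)).
  by move=> n; apply: avail_input.
have [|P2 s2 H2] := cost_fourier (D := fun _ : I -> R[i] => True) (P := P1)
  (a := fun n inp => inp (inr (n, ord_origin pP m))).
  by move=> n; apply: avail_input.
have [P3 s3 H3] := cost_scale (fun _ => p%:R ^+ m) H2.
have H1' u : avail (fun _ => True) (P1 ++ P2 ++ P3) (data_hat^~ u).
  by apply: avail_cat; apply: H1.
have H2' u : avail (fun _ => True) (P1 ++ P2 ++ P3) (kernel_hat^~ u).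
  by rewrite catA; apply: avail_cat; apply: H2.
rewrite -catA in H3.
have [P4 s4 H4] := avail_divs H1' H3.
have H4' u : avail (fun inp => kernel_hat inp u != 0) ((P1 ++ P2 ++ P3) ++ P4)
    (coef_hat^~ u).
  apply: avail_sub (H4 u) => inp nz.
  by rewrite mulf_neq0 // pm_neq0.
have [|P5 s5 H5] := cost_inv_fourier (P := (P1 ++ P2 ++ P3) ++ P4)
  (D := fun inp => forall u, kernel_hat inp u != 0)
  (a := fun u inp => coef_hat inp u).
  by move=> u; apply: avail_sub (H4' u) => inp; apply.
exists (((P1 ++ P2 ++ P3) ++ P4) ++ P5); split=> [|u|u|u|n].
- rewrite !card_ord in s3 s4.
  rewrite !size_cat; apply: leq_trans (leq_add (leq_add
    (leq_add s1 (leq_add s2 s3)) s4) s5) _.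
  by apply: eq_leq; rewrite /N; ring.
- by do 2!apply: avail_cat; apply: H1'.
- by do 2!apply: avail_cat; apply: H2'.
- by apply: avail_cat; apply: H4'.
- exact: H5.
Qed.

End SplineProgram.

Theorem mainTheorem4 (R : realType) :
  (forall (p s m : nat) (C : 'I_s -> 'M['F_p]_m)
      (Khat : s.-tuple nat -> R) (K : 'rV[R]_s -> 'rV[R]_s -> R[i])
      (f : 'rV[R]_s -> R[i]) (c : 'I_(p ^ m) -> R[i]),
    prime p -> (0 < m)%N ->
    (forall k, 0 <= Khat k) ->
    esum.summable [set: s.-tuple nat] (fun k => (Khat k)%:E) ->
    walsh_kernel p Khat K ->
    in_RKHS K f ->
    interpolates C K f c ->
    forall k, wavenumbers C k ->
      [/\ dwt C (fun n => f (netpoint C R n)) k =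
            p%:R ^+ m * (Ktilde C Khat k)%:C * dwt C c k,
          Ktilde C Khat k != 0 ->
            dwt C c k = dwt C (fun n => f (netpoint C R n)) k /
                        (p%:R ^+ m * (Ktilde C Khat k)%:C),
          (forall c', interpolates C K f c' -> c' =1 c) ->
            Ktilde C Khat k != 0
        & (Ktilde C Khat k)%:C = dwt C (fun n => K (netpoint C R n) 0) k])
  /\
  (exists A : R,
    forall (p s m : nat) (C : 'I_s -> 'M['F_p]_m),
    prime p -> (0 < m)%N ->
    exists (P : seq (instr R[i] ('I_(p ^ m) + 'I_(p ^ m) * 'I_(p ^ m))))
      (out_f out_K out_ct :
         s.-tuple nat -> operand ('I_(p ^ m) + 'I_(p ^ m) * 'I_(p ^ m)))
      (out_c : 'I_(p ^ m) -> operand ('I_(p ^ m) + 'I_(p ^ m) * 'I_(p ^ m))),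
      (size P)%:R <= A * (m%:R * p%:R ^+ m * ln p%:R) /\
      forall (Khat : s.-tuple nat -> R) (K : 'rV[R]_s -> 'rV[R]_s -> R[i])
        (f : 'rV[R]_s -> R[i]) (c : 'I_(p ^ m) -> R[i]),
      (forall k, 0 <= Khat k) ->
      esum.summable [set: s.-tuple nat] (fun k => (Khat k)%:E) ->
      walsh_kernel p Khat K ->
      in_RKHS K f ->
      interpolates C K f c ->
      [/\ forall k, wavenumbers C k ->
            output (spline_data C K f) P (out_f k) =
              Some (dwt C (fun n => f (netpoint C R n)) k),
          forall k, wavenumbers C k ->
            output (spline_data C K f) P (out_K k) =
              Some (Ktilde C Khat k)%:C,
          forall k, wavenumbers C k -> Ktilde C Khat k != 0 ->
            output (spline_data C K f) P (out_ct k) = Some (dwt C c k)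
        & (forall c', interpolates C K f c' -> c' =1 c) ->
          forall n, output (spline_data C K f) P (out_c n) = Some (c n)]).
Proof.
split=> [p s m C Khat K f c pP m0 Khat0 Khat_sum KW fH fc k kW|].
  have nz : (p%:R ^+ m : R[i]) != 0 := pm_neq0 R pP m.
  rewrite !dwtE // (KtildeE pP).
  have E := fourier_interpolates pP Khat0 Khat_sum KW (netdot C k) fc.
  split=> // [k0|uniq|].
  - rewrite E mulrC mulKf // mulf_neq0 //.
    by apply: contra k0 => /eqP[->].
  - exact: (unique_kappa_neq0 pP Khat0 Khat_sum KW _ fc uniq).
  - rewrite -(netpoint_origin R pP C).
    by rewrite (fourier_kernel pP C Khat0 Khat_sum KW _ (dvec_origin pP m)).
(* The program has at most 270 m p^m t + 7 p^m <= 277 m p^m t instructions, where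
   t = trunc_log 2 p satisfies t ln 2 <= ln p. *)
exists (277 / ln 2) => p s m C pP m0.
have [P [sP HF HK HC Hc]] := spline_program R pP m.
have pick (D : 'I_(p ^ m) -> ('I_(p ^ m) + 'I_(p ^ m) * 'I_(p ^ m) -> R[i]) -> Prop)
    (g : 'I_(p ^ m) -> ('I_(p ^ m) + 'I_(p ^ m) * 'I_(p ^ m) -> R[i]) -> R[i]) :
  (forall u, avail (D u) P (g u)) ->
  exists o, forall u inp, D u inp -> output inp P (o u) = Some (g u inp).
  move=> H; have H' u : exists o, forall inp, D u inp ->
      output inp P o = Some (g u inp).
    exact: (avail_read (H u)).
  by have [r Hr] := choice H'; exists r.
have [rF {}HF] := pick (fun _ _ => True) _ HF.
have [rK {}HK] := pick (fun _ _ => True) _ HK.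
have [rC {}HC] := pick _ _ HC.
have [rc {}Hc] := pick (fun _ inp => forall u, kernel_hat pP inp u != 0) _ Hc.
have [ix _ ixK] := dvec_bij pP m.
exists P, (fun k => rF (ix (netdot C k))), (fun k => rK (ix (netdot C k))),
  (fun k => rC (ix (netdot C k))), rc; split.
  have sz : (size P <= 277 * (m * p ^ m * trunc_log 2 p))%N.
    apply: leq_trans sP _.
    have : (p ^ m <= m * p ^ m * trunc_log 2 p)%N.
      by rewrite mulnAC leq_pmull // muln_gt0 m0 trunc_log_gt0 /= prime_gt1.
    move=> le; apply: (@leq_trans (270 * (m * p ^ m * trunc_log 2 p)
        + 7 * (m * p ^ m * trunc_log 2 p))).
      by apply: leq_add; [apply: eq_leq; ring | rewrite leq_mul2l le].
    by apply: eq_leq; ring.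
  have ln2 : 0 < ln 2 :> R by rewrite ln_gt0 // ltr1n.
  have tl : ln 2 * (trunc_log 2 p)%:R <= ln p%:R :> R.
    rewrite mulr_natr -lnXn // ler_ln ?posrE ?exprn_gt0 ?ltr0n ?prime_gt0 //.
    by rewrite -natrX ler_nat trunc_logP ?prime_gt0.
  apply: (@le_trans _ _ (277 * (m * p ^ m * trunc_log 2 p))%N%:R).
    by rewrite ler_nat.
  rewrite !natrM natrX -!mulrA ler_pM2l //.
  rewrite [leRHS]mulrCA ler_pM2l ?ltr0n // [leRHS]mulrCA ler_pM2l ?exprn_gt0 ?ltr0n ?prime_gt0 //.
  by rewrite mulrC ler_pdivlMr // mulrC.
move=> Khat K f c Khat0 Khat_sum KW fH fc.
have FE u : data_hat (spline_data C K f) u = fourier (fun n => f (netpoint C R n)) (dvec u) by [].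
have KE u : kernel_hat pP (spline_data C K f) u = (kappa C Khat (dvec u))%:C.
  exact: (fourier_kernel pP C Khat0 Khat_sum KW _ (dvec_origin pP m)).
have nz : (p%:R ^+ m : R[i]) != 0 := pm_neq0 R pP m.
have CE u : kernel_hat pP (spline_data C K f) u != 0 ->
    coef_hat pP (spline_data C K f) u = fourier c (dvec u).
  move=> Knz; rewrite /coef_hat FE (fourier_interpolates pP Khat0 Khat_sum KW _ fc).
  by rewrite -KE mulrC mulKf // mulf_neq0.
split=> [k kW|k kW|k kW k0|uniq n].
- by rewrite HF // FE ixK dwtE.
- by rewrite HK // KE ixK KtildeE.
- have Knz : kernel_hat pP (spline_data C K f) (ix (netdot C k)) != 0.
    rewrite KE ixK -(KtildeE pP); apply: contra k0 => /eqP[->] //.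
  by rewrite HC // CE // ixK dwtE.
- have Knz u : kernel_hat pP (spline_data C K f) u != 0.
    rewrite KE; have := unique_kappa_neq0 pP Khat0 Khat_sum KW (dvec u) fc uniq.
    by apply: contra => /eqP[->].
  rewrite Hc // -(fourier_inv pP c n) inv_fourier_lin //; congr Some.
  by apply: eq_bigr => u _; rewrite CE.
Qed.
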